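(* There exists an absolute constant $C>0$ such that for every non-empty graph $G$ (i.e. a graph with at least one edge) and every connected graph $H$, writing $k=\max(|G|,|H|)$, we have for every integer $n\ge 2^{Ck}$ $$r(G,nH)=n|H|+r(\mathcal{D}(G),H)-1.$$
   Context: All graphs are finite and simple; $|G|$ denotes the number of vertices of $G$. $nH$ denotes the graph consisting of $n$ vertex-disjoint copies of $H$. For two families of graphs $\mathcal{G},\mathcal{H}$, $r(\mathcal{G},\mathcal{H})$ is the smallest integer $N$ such that every colouring of the edges of the complete graph on $N$ vertices with two colours contains a copy (as a not necessarily induced subgraph) of some graph from $\mathcal{G}$ in the first colour or a copy of some graph from $\mathcal{H}$ in the second colour. A single graph in place of a family stands for the family consisting of that graph only. $\mathcal{D}(G)$ is the family of graphs obtained from $G$ by deleting (all vertices of) an inclusion-maximal independent set of $G$. *)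

(* Defs.v *)
From mathcomp Require Import all_boot all_order all_algebra.
From mathcomp Require Import boolp classical_sets reals exp.
Set Implicit Arguments.
Unset Strict Implicit.
Unset Printing Implicit Defensive.

Record sgraph := SGraph {
  vertex :> finType;
  adj : rel vertex;
  adj_sym : symmetric adj;
  adj_irr : irreflexive adj }.

(* Not necessarily induced. *)
Definition subgraph (F K : sgraph) : Prop :=
  exists2 f : F -> K, injective f & forall x y, adj x y -> adj (f x) (f y).

Definition has_edge (G : sgraph) : Prop := exists x y : G, adj x y.

(* The graph without vertices is not connected. *)
Definition connected_graph (G : sgraph) : Prop :=
  0 < #|G| /\ forall x y : G, connect (@adj G) x y.

Section Copies.
Variables (n : nat) (H : sgraph).

Definition copies_adj : rel ('I_n * H) :=
  fun u v => (u.1 == v.1) && adj u.2 v.2.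

Lemma copies_adj_sym : symmetric copies_adj.
Proof. by move=> u v; rewrite /copies_adj eq_sym adj_sym. Qed.

Lemma copies_adj_irr : irreflexive copies_adj.
Proof. by move=> u; rewrite /copies_adj adj_irr andbF. Qed.

Definition copies : sgraph := SGraph copies_adj_sym copies_adj_irr.

End Copies.

Section Delete.
Variables (G : sgraph) (I : {set G}).

Definition delete_adj : rel {x : G | x \notin I} :=
  fun u v => adj (val u) (val v).

Lemma delete_adj_sym : symmetric delete_adj.
Proof. by move=> u v; rewrite /delete_adj adj_sym. Qed.

Lemma delete_adj_irr : irreflexive delete_adj.
Proof. by move=> u; rewrite /delete_adj adj_irr. Qed.

Definition delete : sgraph := SGraph delete_adj_sym delete_adj_irr.

End Delete.

Definition independent (G : sgraph) (I : {set G}) : bool :=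
  [forall x in I, forall y in I, ~~ adj x y].

Definition family := sgraph -> Prop.

Definition single (G : sgraph) : family := fun F => F = G.

Definition delete_family (G : sgraph) : family :=
  fun F => exists2 I : {set G}, maxset (@independent G) I & F = delete I.

(* A colouring of the edges of the complete graph on 'I_N is a map on sets of
   vertices, of which only the values at two-element sets are ever used. *)
Section Colour.
Variables (N : nat) (c : {set 'I_N} -> bool) (b : bool).

Definition colour_adj : rel 'I_N :=
  fun x y => (x != y) && (c [set x; y] == b).

Lemma colour_adj_sym : symmetric colour_adj.
Proof. by move=> x y; rewrite /colour_adj eq_sym finset.setUC. Qed.

Lemma colour_adj_irr : irreflexive colour_adj.
Proof. by move=> x; rewrite /colour_adj eqxx. Qed.

Definition colour_graph : sgraph := SGraph colour_adj_sym colour_adj_irr.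

End Colour.

Definition arrows (A B : family) (N : nat) : Prop :=
  forall c : {set 'I_N} -> bool,
    (exists2 F, A F & subgraph F (colour_graph c true)) \/
    (exists2 F, B F & subgraph F (colour_graph c false)).

(* The smallest N with [arrows A B N]; the default 0 is only taken when there
   is no such N, which by Ramsey's theorem requires A or B to be empty. *)
Definition ramsey (A B : family) : nat :=
  xget 0 [set N | arrows A B N /\ forall M, arrows A B M -> N <= M]%classic.

(* Main.v *)
(** Lower bound: a blue clique on n|H| - 1 vertices joined in red to an extremal
    colouring for (D(G), H).

    Upper bound: without a red K_k, passing to red neighbourhoods at most k times
    yields an exponentially large set S of small red degree. Cover the complement
    of S greedily by blue copies of H, leaving a set U of fewer than 2^(3k)
    vertices, and cover greedily vertices of U by blue cliques with their other
    vertices in S. The vertices left in U have few blue neighbours in the rest A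
    of S, so a red member of D(G) among them would extend into A to a red G; hence
    fewer than r(D(G), H) of them remain. Finally A is covered by blue K_h,
    h = |H|, up to fewer than h vertices, and counting gives n copies.

    To cover A, pack it with blue 2h-cliques. Call w attached to such a clique Q
    if it has h blue neighbours in Q; then w can be put into Q in exchange for any
    vertex of Q, leaving a union of two h-cliques. Red degrees are small, so w is
    attached to most cliques Q, and most Q contain a vertex attached to a given
    Q'. As long as h uncovered vertices remain, take by Ramsey's theorem a blue
    h-clique of vertices z_i in distinct cliques Q'_i, and exchange each uncovered
    w_i for z_i through some Q_i and Q'_i; the z_i form a further tile. *)
Require Import Defs.
From mathcomp Require Import all_boot all_order all_algebra.
From mathcomp Require Import boolp classical_sets reals exp.
From mathcomp Require Import fintype finset ssrAC zify.

Set Implicit Arguments.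
Unset Strict Implicit.
Unset Printing Implicit Defensive.

(** * Tilings and packings of a vertex set *)

Definition clique (T : finType) (e : rel T) (A : {set T}) : Prop :=
  {in A &, forall x y, x != y -> e x y}.

Definition nbr (T : finType) (e : rel T) (x : T) : {set T} := [set y | e x y].

Definition tiled (T : finType) (P : {set T} -> Prop) (X : {set T}) : Prop :=
  exists F : {set {set T}},
    [/\ trivIset F, cover F = X & forall A, A \in F -> P A].

Definition kclique (T : finType) (e : rel T) (k : nat) (A : {set T}) : Prop :=
  clique e A /\ #|A| = k.

Section Tilings.
Variables (T : finType) (P : {set T} -> Prop).
Implicit Types (A X Y : {set T}) (F : {set {set T}}).

Lemma exists_subset_card A m :
  m <= #|A| -> exists2 X : {set T}, X \subset A & #|X| = m.
Proof.
elim: m => [|m IH] mA; first by exists set0; rewrite ?sub0set ?cards0.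
have [X XA Xm] := IH (ltnW mA).
have /properP[_ [x xA xX]] : X \proper A by rewrite properEcard XA Xm.
exists (x |: X); last by rewrite cardsU1 xX Xm.
by apply/subsetP=> y /setU1P[-> // | /(subsetP XA)].
Qed.

Lemma tiled0 : tiled P set0.
Proof.
exists set0; split=> [||A]; rewrite ?inE //; first by rewrite /trivIset /cover !big_set0 cards0.
by rewrite /cover big_set0.
Qed.

Lemma tiled1 A : P A -> tiled P A.
Proof.
by move=> PA; exists [set A]; split; rewrite ?trivIset1 ?cover1 // => B /set1P->.
Qed.

Lemma coverU F1 F2 : cover (F1 :|: F2) = cover F1 :|: cover F2.
Proof. exact: bigcup_setU. Qed.

Lemma tiledU X Y : [disjoint X & Y] -> tiled P X -> tiled P Y -> tiled P (X :|: Y).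
Proof.
move=> dXY [F1 [t1 c1 P1]] [F2 [t2 c2 P2]]; exists (F1 :|: F2); split.
- by apply: trivIsetU; rewrite ?c1 ?c2.
- by rewrite coverU c1 c2.
- by move=> A /setUP[/P1 | /P2].
Qed.

Lemma tiled_cover F :
  trivIset F -> (forall A, A \in F -> tiled P A) -> tiled P (cover F).
Proof.
move: {2}#|F| (erefl #|F|) => m; elim: m F => [|m IH] F Fm tF FP.
  by move/eqP: Fm; rewrite cards_eq0 => /eqP->; rewrite /cover big_set0; apply: tiled0.
have /card_gt0P[A AF] : 0 < #|F| by rewrite Fm.
have dA : [disjoint A & cover (F :\ A)].
  by rewrite coverD1 // disjoint_sym disjoints_subset subsetDr.
rewrite -(setD1K AF) coverU cover1; apply: tiledU => //; first exact: FP.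
apply: IH; last 2 first.
- by apply: trivIsetS tF; rewrite subD1set.
- by move=> B /setD1P[_ /FP].
by move: Fm; rewrite (cardsD1 A) AF => -[].
Qed.

Lemma card_tiled h F :
  (forall A, A \in F -> #|A| = h) -> trivIset F -> #|cover F| = #|F| * h.
Proof.
move=> Fh /eqP <-; rewrite -sum_nat_const; exact: eq_bigr.
Qed.

(** Take a packing that is maximal under inclusion. A set with [P] that is disjoint from its cover
    could be added to it, and being non-empty it is not a member already. *)
Lemma maximal_packing :
  (forall A, P A -> A != set0) ->
  exists F : {set {set T}}, [/\ trivIset F, forall A, A \in F -> P A &
    forall A, P A -> ~~ [disjoint A & cover F]].
Proof.
move=> P0; pose p F := `[< trivIset F /\ forall A, A \in F -> P A >].
have : p set0.
  by apply/asboolP; split=> [|A]; rewrite ?inE // /trivIset /cover !big_set0 cards0.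
case/maxset_exists=> F mF _; have /asboolP[tF PF] := maxsetp mF.
exists F; split=> // A PA; apply/negP=> dA.
have /setP/(_ A) : A |: F = F.
  apply: (maxsetsup mF); last exact: subsetUr.
  apply/asboolP; split; last by move=> B /setU1P[-> | /PF].
  by apply: trivIsetU; rewrite ?trivIset1 ?cover1.
rewrite setU11 => /esym AF; have /set0Pn[x xA] := P0 _ PA.
have xF : x \in cover F by apply/bigcupP; exists A.
by have := disjointFr dA xA; rewrite xF.
Qed.

End Tilings.

(** * Cliques and sparse sets in two colours *)

Section Cliques.
Variables (T : finType) (e : rel T).
Hypothesis (esym : symmetric e).
Implicit Types (A X Y : {set T}).

Lemma cliqueS X Y : X \subset Y -> clique e Y -> clique e X.
Proof. by move=> /subsetP XY cY x y /XY xY /XY yY; apply: cY. Qed.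

Lemma cliqueU1 x Y : clique e Y -> Y \subset nbr e x -> clique e (x |: Y).
Proof.
move=> cY /subsetP xY u v /setU1P[-> | uY] /setU1P[-> | vY]; rewrite ?eqxx //.
- by move=> _; have := xY v vY; rewrite inE.
- by move=> _; have := xY u uY; rewrite inE esym.
- exact: cY.
Qed.

End Cliques.

Section Coloured.
Variables (T : finType) (r b : rel T).
Hypotheses (rsym : symmetric r) (bsym : symmetric b).
Hypothesis rirr : irreflexive r.
Hypothesis total : forall x y, x != y -> r x y || b x y.
Implicit Types (A X Y Q : {set T}) (F : {set {set T}}).

(** Induction on s + t. For x in X, the red and blue neighbourhoods cover the at least 2^(s+t) - 1
    other vertices of X, so one of them has at least 2^(s+t-1) vertices, and x extends a clique of
    that colour found there. *)
Lemma ramsey_clique s t X :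
  2 ^ (s + t) <= #|X| ->
  (exists2 Y : {set T}, Y \subset X & kclique r s Y) \/
  (exists2 Y : {set T}, Y \subset X & kclique b t Y).
Proof.
move Dm : (s + t) => m; elim: m s t Dm X => [|m IH] s t Dm X Xm.
  left; exists set0; first exact: sub0set.
  by split; [move=> x; rewrite inE | rewrite cards0; lia].
case: s Dm => [|s] Dm.
  by left; exists set0; [exact: sub0set | split; [move=> x; rewrite inE | rewrite cards0]].
case: t Dm => [|t] Dm.
  by right; exists set0; [exact: sub0set | split; [move=> x; rewrite inE | rewrite cards0]].
have /card_gt0P[x xX] : 0 < #|X| by apply: leq_trans Xm; rewrite expn_gt0.
pose Xe (e : rel T) := (X :\ x) :&: nbr e x.
have XeX e : Xe e \subset X by rewrite subIset // subD1set.
have Xex e Y : Y \subset Xe e -> x \notin Y.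
  by move=> YX; apply/negP=> /(subsetP YX); rewrite !inE eqxx.
have Xen e Y : Y \subset Xe e -> Y \subset nbr e x.
  by move=> YX; apply: (subset_trans YX); rewrite subsetIr.
have : #|X :\ x| <= #|Xe r| + #|Xe b|.
  apply: leq_trans (leq_card_setU _ _).1; apply/subset_leq_card/subsetP=> y yX.
  have /setD1P[yx _] := yX.
  by rewrite inE /Xe ![y \in _ :&: _]in_setI yX !inE total // eq_sym.
have -> : #|X :\ x| = #|X|.-1 by rewrite (cardsD1 x X) xX.
move=> le; have [Xr | Xr] := leqP (2 ^ m) #|Xe r|.
  have [|[Y YX [cY Ys]] | [Y YX cY]] // := IH s t.+1 _ _ Xr; first by lia.
    left; exists (x |: Y); first by rewrite subUset sub1set xX (subset_trans YX).
    by split; [apply: cliqueU1 => //; apply: Xen | rewrite cardsU1 (Xex r) // Ys].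
  by right; exists Y => //; apply: (subset_trans YX).
have Xb : 2 ^ m <= #|Xe b| by move: Xm; rewrite expnS; lia.
have [|[Y YX cY] | [Y YX [cY Ys]]] // := IH s.+1 t _ _ Xb; first by lia.
  by left; exists Y => //; apply: (subset_trans YX).
right; exists (x |: Y); first by rewrite subUset sub1set xX (subset_trans YX).
by split; [apply: cliqueU1 => //; apply: Xen | rewrite cardsU1 (Xex b) // Ys].
Qed.

(* A vertex of large red degree lets us pass to its red neighbourhood, which
   lowers the red clique number; this stops before k steps. *)
Lemma sparse_subset q m k X :
  0 < q -> (forall Y : {set T}, Y \subset X -> ~ kclique r k Y) -> q ^ k * m <= #|X| ->
  exists2 S : {set T}, S \subset X & m <= #|S| /\
    forall x, x \in S -> q * #|S :&: nbr r x| <= #|S|.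
Proof.
move=> q0; elim: k X => [|k IH] X noK Xm.
  case: (noK set0 (sub0set _)); split; [by move=> x; rewrite inE | exact: cards0].
have [/existsP[x /andP[xX big]] | /existsPn small] :=
    boolP [exists x, (x \in X) && (#|X| < q * #|X :&: nbr r x|)]; last first.
  exists X => //; split.
    by apply: leq_trans Xm; rewrite leq_pmull // expn_gt0 q0.
  by move=> x xX; have := small x; rewrite xX /= -leqNgt.
have [Y YX [cY Yk]||S SX HS] := IH (X :&: nbr r x).
- apply: (noK (x |: Y)).
    by rewrite subUset sub1set xX (subset_trans YX) // subsetIl.
  split; first by apply: cliqueU1 => //; apply: (subset_trans YX); rewrite subsetIr.
  rewrite cardsU1 Yk; case: (boolP (x \in Y)) => // /(subsetP YX).
  by rewrite !inE rirr andbF.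
- rewrite -(leq_pmul2l q0) mulnA -expnS; apply: leq_trans Xm (ltnW big).
- by exists S => //; apply: (subset_trans SX); rewrite subsetIl.
Qed.

End Coloured.

(** * Absorbing vertices into a packing by 2h-cliques *)

Lemma disjointsU1 (T : finType) (x : T) (A B : {set T}) :
  [disjoint x |: A & B] = (x \notin B) && [disjoint A & B].
Proof. by rewrite -!setI_eq0 setIUl setU_eq0 !setI_eq0 disjoints1. Qed.

Section Absorption.
Variables (T : finType) (b : rel T) (h : nat).
Hypotheses (bsym : symmetric b) (h_gt0 : 0 < h).
Implicit Types (A U W X Y Q : {set T}) (F : {set {set T}}).

Definition attached (w : T) Q : bool := h <= #|Q :&: nbr b w|.

(** At least h - 1 neighbours of w in Q differ from c. Together with w, h - 1 of them form one
    h-clique, and the other h vertices of Q without c form the second. *)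
Lemma swap w c Q :
  kclique b h.*2 Q -> w \notin Q -> c \in Q -> attached w Q ->
  tiled (kclique b h) (w |: (Q :\ c)).
Proof.
move=> [cQ Qh] wQ cQ' att.
have [Y YQ Yh] : exists2 Y : {set T}, Y \subset (Q :\ c) :&: nbr b w & #|Y| = h.-1.
  apply: exists_subset_card; move: att; rewrite /attached (cardsD1 c).
  have -> : (Q :&: nbr b w) :\ c = (Q :\ c) :&: nbr b w by rewrite setIDAC.
  by case: (_ \in _) => /=; lia.
have [YQc Yw] := subsetIP YQ.
have YQ' : Y \subset Q by apply: subset_trans YQc (subsetDl _ _).
have wY : w \notin Y by apply: contra wQ; apply/subsetP.
have -> : w |: (Q :\ c) = (w |: Y) :|: ((Q :\ c) :\: Y).
  by rewrite -setUA -[in LHS](setID (Q :\ c) Y) (setIidPr YQc).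
apply: tiledU; last 2 first.
- apply: tiled1; split; first by apply: cliqueU1 => //; apply: cliqueS cQ.
  by rewrite cardsU1 wY Yh; lia.
- apply: tiled1; split; first by apply: cliqueS cQ; rewrite !subDset !subsetU ?subxx ?orbT.
  rewrite cardsD (setIidPr YQc) Yh.
  by have := cardsD1 c Q; rewrite cQ' Qh; lia.
rewrite disjointsU1 !inE (negbTE wQ) !andbF /=.
by rewrite disjoint_sym disjoints_subset subsetDr.
Qed.

(** Two chained swaps: w takes the place of c in Q, and c takes the place of z in Q'. So w is taken
    up and z is set free, although w need not be attached to Q'. *)
Lemma swap2 w c z Q Q' :
  kclique b h.*2 Q -> kclique b h.*2 Q' -> [disjoint Q & Q'] ->
  w \notin Q -> w \notin Q' -> c \in Q -> z \in Q' -> attached w Q -> attached c Q' ->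
  tiled (kclique b h) (w |: (Q :|: (Q' :\ z))).
Proof.
move=> kQ kQ' dQ wQ wQ' cQ zQ' aw ac.
have cQ' : c \notin Q' by rewrite (disjointFr dQ).
have -> : w |: (Q :|: (Q' :\ z)) = (w |: (Q :\ c)) :|: (c |: (Q' :\ z)).
  by rewrite -[in LHS](setD1K cQ) -!setUA (setUCA [set c]).
apply: tiledU; [| exact: swap | exact: swap].
rewrite disjointsU1 !inE (negbTE wQ') andbF orbF; apply/andP; split.
  by apply: contra wQ => /eqP->.
rewrite disjoint_sym disjointsU1 !inE eqxx /= disjoint_sym.
by apply: disjointW dQ; rewrite subD1set.
Qed.

(* Exchanges W for the representatives z A, A in Z; the blocks of F' serve as
   intermediate stops. *)
Lemma exchange beta (z : {set T} -> T) j F W (Z : {set {set T}}) :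
  trivIset F -> (forall A, A \in F -> kclique b h.*2 A /\ z A \in A) ->
  (forall w, w \in W -> #|[set Q in F | ~~ attached w Q]| <= beta) ->
  (forall Q', Q' \in F ->
    #|[set Q in F | [forall c in Q, ~~ attached c Q']]| <= beta) ->
  [disjoint W & cover F] -> Z \subset F -> #|W| = j -> #|Z| = j ->
  beta.*2 + j.*2 < #|F| ->
  exists2 F' : {set {set T}}, F' \subset F :\: Z & #|F'| = j /\
    tiled (kclique b h) (W :|: cover F' :|: \bigcup_(A in Z) (A :\ z A)).
Proof.
elim: j F W Z => [|j IH] F W Z tF FP Fw FQ dW ZF Wj Zj big.
  exists set0; first exact: sub0set.
  split; first exact: cards0.
  move/eqP: Wj; rewrite cards_eq0 => /eqP->; move/eqP: Zj; rewrite cards_eq0 => /eqP->.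
  by rewrite /cover !big_set0 !setU0; apply: tiled0.
have /card_gt0P[w wW] : 0 < #|W| by rewrite Wj.
have /card_gt0P[Q' Q'Z] : 0 < #|Z| by rewrite Zj.
have Q'F := subsetP ZF _ Q'Z.
pose B1 := [set Q in F | ~~ attached w Q].
pose B2 := [set Q in F | [forall c in Q, ~~ attached c Q']].
(* A block Q outside all three sets is an intermediate stop from w to Q'. Afterwards Q and Q' leave
   F, so the size bound, which drops by two with j, is preserved. *)
have : ~~ (F \subset B1 :|: B2 :|: Z).
  apply/negP=> /subset_leq_card; apply/negP; rewrite -ltnNge; apply: leq_ltn_trans big.
  apply: leq_trans (leq_card_setU _ _).1 _; rewrite Zj.
  have := (leq_card_setU B1 B2).1; have := Fw _ wW; have := FQ _ Q'F.
  by rewrite -/B1 -/B2; lia.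
case/subsetPn=> Q QF; rewrite !inE QF /= !negb_or negbK => /andP[/andP[aw]].
case/forall_inPn=> c cQ; rewrite negbK => ac QZ.
have QQ' : Q != Q' by apply: contraNneq QZ => ->.
have dQ : [disjoint Q & Q'] by apply: (trivIsetP tF).
have wF A : A \in F -> w \notin A.
  by move=> AF; apply: contraFN (disjointFr dW wW) => wA; apply/bigcupP; exists A.
pose F1 := F :\ Q' :\ Q.
have F1F : F1 \subset F by rewrite /F1 !subDset !subsetU ?subxx ?orbT.
have F1mono (p : pred {set T}) m : #|[set A in F | p A]| <= m -> #|[set A in F1 | p A]| <= m.
  apply: leq_trans; apply/subset_leq_card/subsetP=> A; rewrite !inE.
  by case/andP=> /and3P[_ _ ->] ->.
have t1 : trivIset (F :\ Q') by apply: trivIsetS tF; rewrite subD1set.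
have QF1 : Q \in F :\ Q' by rewrite !inE QQ'.
have cF1 : cover F1 = cover F :\: Q' :\: Q by rewrite /F1 !coverD1.
have [|||||||||F' F'F [F'j til]] // := IH F1 (W :\ w) (Z :\ Q').
- by apply: trivIsetS tF.
- by move=> A /(subsetP F1F)/FP.
- by move=> v /setD1P[_ /Fw]; apply: F1mono.
- by move=> A /(subsetP F1F)/FQ; apply: F1mono.
- apply: disjointW dW; first by rewrite subD1set.
  by rewrite cF1 !subDset !subsetU ?subxx ?orbT.
- apply/subsetP=> A; rewrite !inE => /andP[-> AZ]; rewrite (subsetP ZF) // !andbT.
  by apply: contraNneq QZ => <-.
- by move: Wj; rewrite (cardsD1 w W) wW => -[].
- by move: Zj; rewrite (cardsD1 Q' Z) Q'Z => -[].
- by move: big; rewrite (cardsD1 Q' F) (cardsD1 Q (F :\ Q')) Q'F QF1 !doubleS !addnS.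
exists (Q |: F').
  apply/subsetP=> A /setU1P[-> | /(subsetP F'F)]; first by rewrite !inE QZ.
  rewrite !inE => /andP[]; rewrite negb_and negbK => AZ /and3P[_ AQ ->].
  by case/orP: AZ => [/eqP|->] // /eqP; rewrite (negbTE AQ).
have QF' : Q \notin F' by apply/negP=> /(subsetP F'F); rewrite !inE eqxx andbF.
split; first by rewrite cardsU1 QF' F'j.
rewrite -(setD1K Q'Z) bigcup_setU big_set1 -(setD1K wW) coverU cover1.
have -> : w |: (W :\ w) :|: (Q :|: cover F') :|:
    (Q' :\ z Q' :|: \bigcup_(A in Z :\ Q') (A :\ z A)) =
    (w |: (Q :|: (Q' :\ z Q'))) :|:
    ((W :\ w) :|: cover F' :|: \bigcup_(A in Z :\ Q') (A :\ z A)).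
  exact: (AC (2*2*2) ((1*(3*5))*((2*4)*6))).
apply: tiledU => //; last first.
  have [kQ _] := FP _ QF; have [kQ' zQ'] := FP _ Q'F.
  by apply: swap2 ac => //; apply: wF.
rewrite -setI_eq0 -subset0; apply/subsetP=> x; rewrite in_setI => /andP[xl xr].
have {}xl : x = w \/ x \in Q :|: Q'.
  by move: xl; rewrite !inE => /or3P[/eqP|->|/andP[_ ->]]; rewrite ?orbT; auto.
have {}xr : x \in W :\ w \/ x \in cover (F :\ Q' :\ Q).
  move: xr; rewrite !in_setU => /orP[/orP[]|]; first by left.
    case/bigcupP=> A AF' xA; right; apply/bigcupP; exists A => //.
    by have := subsetP F'F _ AF'; rewrite inE => /andP[].
  case/bigcupP=> A /setD1P[AQ' AZ] /setD1P[_ xA]; right; apply/bigcupP; exists A => //.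
  rewrite !inE AQ' (subsetP ZF) // !andbT; by apply: contraNneq QZ => <-.
rewrite -/F1 cF1 in xr; case: xr.
  case/setD1P=> xw xW; case: xl => [xw'|]; first by rewrite xw' eqxx in xw.
  have xF : x \notin cover F by rewrite (disjointFr dW xW).
  by case/setUP=> xA; case/negP: xF; apply/bigcupP; [exists Q|exists Q'].
case/setDP=> /setDP[xF xQ'] xQ; case: xl => [xw|].
  by rewrite xw (disjointFr dW wW) in xF.
by rewrite inE (negbTE xQ) (negbTE xQ').
Qed.

Variable R : nat.
Hypothesis ram : forall X, R <= #|X| -> exists2 Z : {set T}, Z \subset X & kclique b h Z.

(** Among the representatives of the blocks there is an h-clique Z. Exchanging W for Z uses the h
    blocks represented in Z and h intermediate ones, hence 2h blocks, and Z itself serves as the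
    last tile. *)
Lemma absorb_one beta F W :
  trivIset F -> (forall A, A \in F -> kclique b h.*2 A) ->
  (forall w, w \in W -> #|[set Q in F | ~~ attached w Q]| <= beta) ->
  (forall Q', Q' \in F ->
    #|[set Q in F | [forall c in Q, ~~ attached c Q']]| <= beta) ->
  [disjoint W & cover F] -> #|W| = h -> beta.*2 + h.*2 < #|F| -> R <= #|F| ->
  exists2 F' : {set {set T}}, F' \subset F & #|F'| = h.*2 /\
    tiled (kclique b h) (W :|: cover F').
Proof.
move=> tF FP Fw FQ dW Wh big RF.
have /card_gt0P[w0 _] : 0 < #|W| by rewrite Wh.
(* The default [w0] is never taken on F, whose blocks are non-empty. *)
pose z A := odflt w0 [pick x in A].
have zP A : A \in F -> z A \in A.
  move=> AF; rewrite /z; case: pickP => //= A0; have [_] := FP _ AF.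
  by rewrite eq_card0 //; lia.
have zinj : {in F &, injective z}.
  move=> A B AF BF zAB; apply/eqP; case: (eqVneq A B) => // AB.
  have := disjointFr (trivIsetP tF _ _ AF BF AB) (zP _ AF).
  by rewrite zAB zP.
have [|Z ZF [cZ Zh]] := ram (X := z @: F); first by rewrite card_in_imset.
pose G := [set A in F | z A \in Z].
have GF : G \subset F by apply/subsetP=> A; rewrite inE => /andP[].
have zG : z @: G = Z.
  apply/setP=> x; apply/imsetP/idP=> [[A]|xZ]; first by rewrite inE => /andP[_ ? ->].
  have /imsetP[A AF xA] := subsetP ZF _ xZ.
  by exists A; rewrite // inE AF -xA.
have Gh : #|G| = h by rewrite -Zh -zG card_in_imset //; apply: sub_in2 zinj; apply/subsetP.
have [|F' F'F [F'h til]] :=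
    exchange (beta := beta) (z := z) tF _ Fw FQ dW GF Wh Gh big.
  by move=> A AF; split; [exact: FP | exact: zP].
have /subsetDP[F'F1 dF'] := F'F.
exists (F' :|: G); first by rewrite subUset F'F1.
split.
  rewrite cardsU (eqP (_ : F' :&: G == set0)) ?setI_eq0 // cards0 F'h Gh; lia.
have -> : W :|: cover (F' :|: G) =
    (W :|: cover F' :|: \bigcup_(A in G) (A :\ z A)) :|: Z.
  rewrite coverU setUA -[RHS]setUA; congr (_ :|: _).
  apply/setP=> x; rewrite in_setU; apply/bigcupP/orP.
    case=> A AG xA; have [->|xz] := eqVneq x (z A).
      by right; rewrite -zG imset_f.
    by left; apply/bigcupP; exists A; rewrite // !inE xz.
  case; first by case/bigcupP=> A AG /setD1P[_ xA]; exists A.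
  rewrite -zG => /imsetP[A AG ->]; exists A; rewrite // zP //; exact: (subsetP GF).
apply: tiledU => //; last by apply: tiled1.
rewrite disjoint_sym -zG -setI_eq0 -subset0; apply/subsetP=> x /setIP[/imsetP[A AG ->]].
have AF := subsetP GF _ AG; have zA := zP _ AF.
rewrite !in_setU => /orP[/orP[zW|]|].
- by have /bigcupP[] := disjointFr dW zW; exists A.
- case/bigcupP=> B BF' zB; have BF := subsetP F'F1 _ BF'.
  have AB : A = B.
    by apply/eqP; apply: contraTT zB => AB; rewrite (disjointFr (trivIsetP tF _ _ AF BF AB)).
  by have := disjointFr dF' BF'; rewrite -AB AG.
case/bigcupP=> B BG /setD1P[zAB zB]; have BF := subsetP GF _ BG.
have AB : A = B.
  by apply/eqP; apply: contraTT zB => AB; rewrite (disjointFr (trivIsetP tF _ _ AF BF AB)).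
by rewrite AB eqxx in zAB.
Qed.

Lemma tiled_double Q : kclique b h.*2 Q -> tiled (kclique b h) Q.
Proof.
move=> [cQ Qh]; have [Y YQ Yh] : exists2 Y : {set T}, Y \subset Q & #|Y| = h.
  by apply: exists_subset_card; rewrite Qh; lia.
rewrite -(setID Q Y) (setIidPr YQ); apply: tiledU.
- by rewrite disjoint_sym disjoints_subset subsetDr.
- by apply: tiled1; split => //; apply: cliqueS cQ.
apply: tiled1; split; first by apply: cliqueS cQ; apply: subsetDl.
by rewrite cardsD (setIidPr YQ) Qh Yh; lia.
Qed.

(** Each round takes h vertices from U and 2h blocks from F, so both sides of the size bound fall by
    2h and the hypothesis survives until fewer than h vertices are left. The untouched blocks are
    then halved. *)
Lemma absorb beta F U :
  trivIset F -> (forall A, A \in F -> kclique b h.*2 A) ->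
  (forall w, w \in U -> #|[set Q in F | ~~ attached w Q]| <= beta) ->
  (forall Q', Q' \in F ->
    #|[set Q in F | [forall c in Q, ~~ attached c Q']]| <= beta) ->
  [disjoint U & cover F] -> beta.*2 + #|U|.*2 + R < #|F| ->
  exists2 U' : {set T}, U' \subset U & #|U'| < h /\
    tiled (kclique b h) (cover F :|: (U :\: U')).
Proof.
have [m] := ubnP #|U|; elim: m => // m IH in F U * => Um tF FP Fw FQ dU big.
have [Uh | hU] := ltnP #|U| h.
  exists U; rewrite ?setDv ?setU0 //; split=> //.
  by apply: tiled_cover => // A /FP; apply: tiled_double.
have [W WU Wh] := exists_subset_card hU.
have WF : [disjoint W & cover F] by apply: disjointWl dU.
have [|||F' F'F [F'h til]] := absorb_one tF FP _ FQ WF Wh.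
- by move=> w /(subsetP WU)/Fw.
- by move: big hU; clear; lia.
- by move: big; clear; lia.
have DF : F :\: F' \subset F by apply: subsetDl.
have mono (p : pred {set T}) n :
    #|[set A in F | p A]| <= n -> #|[set A in F :\: F' | p A]| <= n.
  apply: leq_trans; apply/subset_leq_card/subsetP=> A; rewrite !inE.
  by case/andP=> /andP[_ ->] ->.
have cF : cover F = cover F' :|: cover (F :\: F').
  by rewrite -coverU -{1}(setID F F') (setIidPr F'F).
have [|||||||U' U'U [U'h til']] // := IH (F :\: F') (U :\: W).
- by have := cardsD U W; rewrite (setIidPr WU); lia.
- exact: trivIsetS tF.
- by move=> A /(subsetP DF)/FP.
- by move=> v /setDP[/Fw vU _]; apply: mono.
- by move=> A /(subsetP DF)/FQ; apply: mono.
- by apply: disjointW dU; rewrite ?subsetDl // cF subsetUr.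
- have := cardsD U W; have := cardsD F F'; rewrite (setIidPr WU) (setIidPr F'F); lia.
have /subsetDP[U'U1 dU'W] := U'U.
exists U' => //; split=> //.
have -> : cover F :|: (U :\: U') =
    (W :|: cover F') :|: (cover (F :\: F') :|: (U :\: W :\: U')).
  have -> : U :\: U' = W :|: (U :\: W :\: U').
    rewrite -{1}(setID U W) (setIidPr WU) setDUl; congr (_ :|: _).
    by apply/setDidPl; rewrite disjoint_sym.
  by rewrite cF -!setUA [in RHS]setUCA; congr (_ :|: _); rewrite setUCA.
apply: tiledU => //; rewrite -setI_eq0 setIUl !setIUr !setU_eq0 !setI_eq0.
apply/andP; split; apply/andP; split.
- by apply: disjointWr WF; rewrite cF subsetUr.
- rewrite disjoint_sym disjoints_subset.
  by apply: subset_trans (subsetDl _ _) _; apply: subsetDr.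
- rewrite -setI_eq0 -subset0; apply/subsetP=> x /setIP[/bigcupP[A AF' xA]].
  case/bigcupP=> B /setDP[BF BF'] xB; have AF := subsetP F'F _ AF'.
  have AB : A != B by apply: contraNneq BF' => <-.
  by have := disjointFr (trivIsetP tF _ _ AF BF AB) xA; rewrite xB.
- rewrite disjoint_sym; apply: disjointW dU; first by rewrite !subDset !subsetU ?subxx ?orbT.
  by rewrite cF subsetUl.
Qed.

End Absorption.

(** * Tiling a set of small red degree *)

Section DenseTiling.
Variables (T : finType) (r b : rel T).
Hypotheses (rsym : symmetric r) (bsym : symmetric b).
Hypothesis total : forall x y, x != y -> r x y || b x y.
Implicit Types (A X Q : {set T}) (F : {set {set T}}).

Lemma card_setI_sum A X : #|A :&: X| = \sum_(x in A) (x \in X).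
Proof.
rewrite -sum1_card -big_mkcondr /=; apply: eq_bigl => x; exact: in_setI.
Qed.

Lemma double_count A X :
  \sum_(x in A) #|X :&: nbr r x| = \sum_(y in X) #|A :&: nbr r y|.
Proof.
under eq_bigr do rewrite card_setI_sum; rewrite exchange_big /=.
apply: eq_bigr => y _; rewrite card_setI_sum; apply: eq_bigr => x _.
by rewrite !inE rsym.
Qed.

Lemma count_blocks m F X :
  trivIset F -> (forall Q, Q \in F -> m <= #|Q :&: X|) -> #|F| * m <= #|cover F :&: X|.
Proof.
move=> tF FX; rewrite card_setI_sum big_trivIset //= -sum_nat_const.
by apply: leq_sum => Q /FX; rewrite card_setI_sum.
Qed.

(** Q has at least 2h - 1 vertices other than c, of which at most h - 1 are blue neighbours of c. *)
Lemma not_attached h c Q :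
  0 < h -> #|Q| = h.*2 -> ~~ attached b h c Q -> h <= #|Q :&: nbr r c|.
Proof.
move=> h0 Qh; rewrite /attached -ltnNge => bl.
have : #|Q :\ c| <= #|Q :&: nbr r c| + #|Q :&: nbr b c|.
  apply: leq_trans (leq_card_setU _ _).1; apply/subset_leq_card/subsetP=> y.
  by case/setD1P=> yc yQ; rewrite !inE yQ /= total // eq_sym.
by have := cardsD1 c Q; case: (c \in Q) => /=; lia.
Qed.

Lemma dense_tiling h M d A :
  0 < h -> (forall X, M <= #|X| -> exists2 Z : {set T}, Z \subset X & kclique b h.*2 Z) ->
  (forall x, x \in A -> #|A :&: nbr r x| <= d) -> 4 * d + 7 * (h * M) <= #|A| ->
  exists2 U : {set T}, U \subset A & #|U| < h /\ tiled (kclique b h) (A :\: U).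
Proof.
move=> h0 ram deg big.
have ram0 X : kclique b h.*2 X -> X != set0 by move=> [_ Xh]; rewrite -card_gt0; lia.
have [X [_ kX]|F [tF FP Fmax]] := @maximal_packing _ (fun X => X \subset A /\ kclique b h.*2 X).
  exact: ram0.
set U := A :\: cover F.
have FA : cover F \subset A by apply/bigcupsP=> Q /FP[].
have UM : #|U| < M.
  rewrite ltnNge; apply/negP=> /ram[Z /subsetDP[ZA ZF] kZ].
  by move: (Fmax Z); rewrite ZF => /(_ (conj ZA kZ)).
have cF : #|cover F| = #|F| * h.*2 by apply: card_tiled => // Q /FP[_ []].
have cA : #|A| = #|cover F| + #|U| by rewrite -(cardsID (cover F) A) (setIidPr FA).
have sub (p : pred {set T}) : [set Q in F | p Q] \subset F.
  by apply/subsetP=> Q; rewrite inE => /andP[].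
have coverS (G : {set {set T}}) : G \subset F -> cover G \subset A.
  by move=> GF; apply/bigcupsP=> Q /(subsetP GF)/FP[].
(* Disjoint blocks with h red neighbours of x each exhaust the red degree d of x after d/h blocks;
   this is the value of [beta] used below. *)
have bound (p : pred {set T}) x : x \in A ->
    (forall Q, Q \in F -> p Q -> h <= #|Q :&: nbr r x|) -> #|[set Q in F | p Q]| <= d %/ h.
  move=> xA px; rewrite leq_divRL //.
  apply: leq_trans (deg _ xA); apply: leq_trans (count_blocks (m := h) (X := nbr r x) _ _) _.
  - exact: trivIsetS tF.
  - by move=> Q; rewrite inE => /andP[]; apply: px.
  - by rewrite subset_leq_card // setSI // coverS.
have [||||||U' U'U [U'h til]] := @absorb _ _ h bsym h0 M _ (d %/ h) F U tF.
- move=> X /ram[Z ZX [cZ Zh]]; have [|Y YZ Yh] := @exists_subset_card _ Z h; first by lia.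
  by exists Y; [apply: subset_trans ZX | split=> //; apply: cliqueS cZ].
- by move=> Q /FP[].
- move=> w /setDP[wA _]; apply: (bound _ w) => // Q /FP[_ [_ Qh]].
  exact: not_attached.
(* Count the red pairs between Q' and the blocks in B. Each of the 2h|B| vertices of these blocks
   has at least h red neighbours in Q', and each of the 2h vertices of Q' has red degree at most d,
   so |B| is at most d/h again. *)
- move=> Q' Q'F; set B := finset _; have BF : B \subset F by apply: sub.
  have [Q'A [_ Q'h]] := FP _ Q'F.
  have cB : #|cover B| = #|B| * h.*2.
    by apply: card_tiled; [move=> Q /(subsetP BF)/FP[_ []] | apply: trivIsetS tF].
  have : #|cover B| * h <= \sum_(x in cover B) #|Q' :&: nbr r x|.
    rewrite -sum_nat_const; apply: leq_sum => x /bigcupP[Q].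
    rewrite inE => /andP[_ /forall_inP Qc] xQ.
    by apply: not_attached => //; apply: Qc.
  rewrite double_count cB.
  have : \sum_(y in Q') #|cover B :&: nbr r y| <= #|Q'| * d.
    rewrite -sum_nat_const; apply: leq_sum => y /(subsetP Q'A) yA.
    by apply: leq_trans (deg _ yA); rewrite subset_leq_card // setSI // coverS.
  rewrite Q'h => le1 le2; have := leq_trans le2 le1; rewrite leq_divRL //.
  by rewrite mulnAC mulnC leq_pmul2l //; lia.
- by rewrite disjoints_subset; apply/subsetP=> x; rewrite !inE => /andP[].
(* After multiplication by 2h it suffices that 4d + 4h|U| + 2hM < |A| - |U|. As |U| < M, this
   follows from 4d + 7hM <= |A|. *)
- rewrite -(ltn_pmul2l h0) -(@ltn_pmul2l 2) //.
  have := leq_divM d h; rewrite mulnC.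
  by move: big; rewrite cA cF; nia.
exists U'; first by apply: subset_trans U'U _; apply: subsetDl.
split=> //; congr (tiled _ _): til.
rewrite -[in RHS](setID A (cover F)) (setIidPr FA) setDUl; congr (_ :|: _).
apply/esym/setDidPl; rewrite disjoint_sym; apply: disjointWl U'U _.
by rewrite disjoints_subset; apply/subsetP=> x; rewrite !inE => /andP[].
Qed.

End DenseTiling.

(** * Embeddings of graphs into coloured vertex sets *)

Lemma pair_colouring (T : finType) (col : rel T) :
  symmetric col ->
  exists c : {set T} -> bool, forall x y, x != y -> c [set x; y] = col x y.
Proof.
move=> csym; exists (fun X : {set T} => [exists x in X, exists y in X, (x != y) && col x y]).
move=> x y xy; apply/exists_inP/idP; last first.
  move=> cxy; exists x; first by rewrite !inE eqxx.
  by apply/exists_inP; exists y; rewrite ?xy // !inE eqxx orbT.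
case=> u /set2P[]-> /exists_inP[v /set2P[]->]; rewrite ?eqxx //=; first by case/andP.
by rewrite csym; case/andP.
Qed.

Section Embeddings.
Variables (T : finType).
Implicit Types (K G : sgraph) (r b e : rel T) (A C U X Q : {set T}) (F : {set {set T}}).

(** Stated for a relation on T and a target set, so that no graph has to be built on each subset of
    T that occurs. *)
Definition embeds (K : sgraph) e U : Prop :=
  exists2 f : K -> T, injective f &
    (forall x, f x \in U) /\ forall x y, adj x y -> e (f x) (f y).

Definition tile (K : sgraph) e X : Prop := embeds K e X /\ #|X| = #|K|.

Lemma embedsS K e U X : U \subset X -> embeds K e U -> embeds K e X.
Proof. by move=> /subsetP UX [f finj [fU fe]]; exists f => //; split=> // x; apply: UX. Qed.

Lemma clique_embeds K e Q : clique e Q -> #|K| <= #|Q| -> embeds K e Q.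
Proof.
move=> cQ KQ; pose f (x : K) := enum_val (widen_ord KQ (enum_rank x)).
have finj : injective f.
  by move=> x y /enum_val_inj/(congr1 val) /= /val_inj/enum_rank_inj.
exists f => //; split=> [x|x y xy]; first exact: enum_valP.
apply: cQ; try exact: enum_valP.
by apply: contraTneq xy => /finj ->; rewrite adj_irr.
Qed.

Lemma clique_tile K e Q : kclique e #|K| Q -> tile K e Q.
Proof. by move=> [cQ Qk]; split=> //; apply: clique_embeds; rewrite ?Qk. Qed.

Lemma embeds_tile K e U :
  embeds K e U -> exists2 X : {set T}, X \subset U & tile K e X.
Proof.
case=> f finj [fU fe]; exists (f @: setT).
  by apply/subsetP=> _ /imsetP[x _ ->].
split; last by rewrite card_imset // cardsT.
by exists f => //; split=> // x; apply: imset_f.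
Qed.

Lemma tiles_copies n K e F :
  trivIset F -> (forall X, X \in F -> tile K e X) -> n <= #|F| ->
  embeds (copies n K) e setT.
Proof.
move=> tF FK nF; pose X (i : 'I_n) := enum_val (widen_ord nF i).
have XF i : X i \in F by apply: enum_valP.
have ex i : exists f : K -> T, injective f /\
    ((forall x, f x \in X i) /\ forall x y, adj x y -> e (f x) (f y)).
  by have [[f ? ?] _] := FK _ (XF i); exists f.
have [g gP] := choice ex.
exists (fun u : copies n K => g u.1 u.2).
  move=> [i x] [j y] /= gxy; have [ij|ij] := eqVneq i j.
    by move: gxy; rewrite -ij => /(proj1 (gP i)) ->.
  have Xij : X i != X j by apply: contra ij => /eqP/enum_val_inj/(congr1 val)/= /val_inj ->.
  have := disjointFr (trivIsetP tF _ _ (XF i) (XF j) Xij) ((gP i).2.1 x).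
  by rewrite gxy (gP j).2.1.
split=> [x|[i x] [j y]]; first by rewrite inE.
by case/andP=> /= /eqP <- xy; apply: (gP i).2.2.
Qed.

Lemma exists_injection (S : finType) (x0 : T) (I : {set S}) C :
  #|I| <= #|C| ->
  exists2 g : S -> T, {in I &, injective g} & forall x, x \in I -> g x \in C.
Proof.
move=> IC; pose g x := nth x0 (enum C) (index x (enum I)).
have ltC x : x \in I -> index x (enum I) < size (enum C).
  by move=> xI; rewrite -cardE; apply: leq_trans IC; rewrite [in ltnRHS]cardE index_mem mem_enum.
exists g => [x y xI yI /eqP|x xI]; last by rewrite -mem_enum mem_nth // ltC.
rewrite /g nth_uniq ?enum_uniq ?ltC // => /eqP xy.
by apply: (index_inj x _ _ xy); rewrite mem_enum.
Qed.

Lemma leq_card_bigcup (S : finType) (f : S -> {set T}) m :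
  (forall x, #|f x| <= m) -> #|\bigcup_x f x| <= #|S| * m.
Proof.
move=> fm; rewrite -sum_nat_const.
elim/big_rec2: _ => [|x n X _ Xn]; first by rewrite cards0.
by rewrite (leq_trans (leq_card_setU _ _).1) // leq_add.
Qed.

(* I is placed in the common red neighbourhood inside A. *)
Lemma embeds_delete (x0 : T) r (G : sgraph) (I : {set G}) U A m :
  symmetric r -> independent I -> embeds (delete I) r U -> [disjoint U & A] ->
  (forall u, u \in U -> #|A :\: nbr r u| <= m) -> #|G| * m + #|G| <= #|A| ->
  embeds G r setT.
Proof.
move=> rsym indI [f finj [fU fr]] dUA Um big.
(* Vertices of A that miss a red edge to the embedded copy of [delete I]. Outside [bad], any |I|
   vertices of A can play the role of I, which has no inner edges to respect. *)
pose bad := \bigcup_(x : delete I) (A :\: nbr r (f x)).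
have lebad : #|bad| <= #|G| * m.
  have := @leq_card_bigcup (delete I) (fun x => A :\: nbr r (f x)) m (fun x => Um _ (fU x)).
  move/leq_trans; apply; rewrite leq_mul2r; apply/orP; right.
  exact: (leq_card (val : delete I -> G) val_inj).
have leI : #|I| <= #|A :\: bad|.
  have IG : #|I| <= #|G| := max_card _.
  have Ab : #|A :&: bad| <= #|bad| := subset_leq_card (subsetIr A bad).
  by rewrite cardsD; move: IG Ab lebad big; clear; lia.
have [g ginj gC] := exists_injection x0 leI.
pose F x := if insub x : option {x : G | x \notin I} is Some v then f v else g x.
have FI x : x \in I -> F x = g x by move=> xI; rewrite /F insubF // xI.
have FnI x (xI : x \notin I) : F x = f (exist _ x xI) by rewrite /F insubT.
have cross x y : x \in I -> y \notin I -> r (F x) (F y) /\ F x != F y.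
  move=> xI yI; rewrite FI // FnI; set v := exist _ _ _.
  have /setDP[gA gbad] := gC _ xI; split.
    rewrite rsym; apply: contraNT gbad => nr; apply/bigcupP; exists v => //.
    by rewrite !inE gA andbT.
  by apply: contraTneq gA => ->; rewrite (disjointFr dUA).
exists F.
  move=> x y; case: (boolP (x \in I)) => xI; case: (boolP (y \in I)) => yI Fxy.
  - by apply: ginj => //; rewrite -!FI.
  - by have [_] := cross x y xI yI; rewrite Fxy eqxx.
  - by have [_] := cross y x yI xI; rewrite Fxy eqxx.
  - by move: Fxy; rewrite !FnI => /finj/(congr1 val).
split=> [x|x y xy]; first by rewrite inE.
case: (boolP (x \in I)) => xI; case: (boolP (y \in I)) => yI.
- by move/forall_inP: indI => /(_ x xI)/forall_inP/(_ y yI); rewrite xy.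
- by have [] := cross x y xI yI.
- by rewrite rsym; have [] := cross y x yI xI.
- by rewrite !FnI; apply: fr.
Qed.

(** Carries the arrow relation from 'I_N to a subset of T: a pair gets the first colour exactly when
    [r] holds, so by [total] a pair of the second colour satisfies [b]. *)
Lemma arrows_embeds (A B : Defs.family) N r b U :
  symmetric r -> (forall x y, x != y -> r x y || b x y) ->
  arrows A B N -> N <= #|U| ->
  (exists2 K, A K & embeds K r U) \/ (exists2 K, B K & embeds K b U).
Proof.
move=> rsym total arr NU; pose g (i : 'I_N) := enum_val (widen_ord NU i).
have ginj : injective g by move=> i j /enum_val_inj/(congr1 val)/= /val_inj.
have [|c cE] := @pair_colouring _ (fun i j => r (g i) (g j)).
  by move=> i j; rewrite rsym.
case: (arr c) => -[K PK [f finj fadj]]; [left | right]; exists K => //; exists (g \o f).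
- exact: inj_comp.
- split=> [x|x y /fadj /andP[xy]]; first exact: enum_valP.
  by rewrite cE // => /eqP.
- exact: inj_comp.
split=> [x|x y /fadj /andP[xy]]; first exact: enum_valP.
rewrite cE // => /eqP nr; have := total (g (f x)) (g (f y)).
by rewrite nr /=; apply; rewrite (inj_eq ginj).
Qed.

End Embeddings.

Lemma colour_total N (c : {set 'I_N} -> bool) x y :
  x != y -> colour_adj c true x y || colour_adj c false x y.
Proof. by move=> xy; rewrite /colour_adj xy; case: (c _). Qed.

Lemma embeds_colour N (c : {set 'I_N} -> bool) v K :
  embeds K (colour_adj c v) setT -> subgraph K (colour_graph c v).
Proof. by case=> f finj [_ fe]; exists f. Qed.

(** Finiteness of the Ramsey number: a clique on |G| or |H| vertices contains the graph in
    question. *)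
Lemma arrows_ramsey (A B : Defs.family) (G H : sgraph) :
  A G -> B H -> arrows A B (2 ^ (#|G| + #|H|)).
Proof.
move=> AG BH c.
have [|[Q _ [cQ Qk]]|[Q _ [cQ Qk]]] := ramsey_clique (colour_adj_sym c true)
    (colour_adj_sym c false) (@colour_total _ c) (s := #|G|) (t := #|H|) (X := setT).
- by rewrite cardsT card_ord.
- left; exists G => //; apply: embeds_colour; apply: (embedsS (subsetT Q)).
  by apply: clique_embeds; rewrite ?Qk.
right; exists H => //; apply: embeds_colour; apply: (embedsS (subsetT Q)).
by apply: clique_embeds; rewrite ?Qk.
Qed.

(** * The upper bound *)

Lemma exists_copies (T : finType) (r b : rel T) (G H : sgraph) (R n : nat) :
  symmetric r -> irreflexive r -> symmetric b ->
  (forall x y, x != y -> r x y || b x y) ->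
  1 < #|G| -> 0 < #|H| -> ~ embeds G r setT ->
  arrows (delete_family G) (single H) R ->
  n * #|H| + R - 1 <= #|T| -> 2 ^ (11 * maxn #|G| #|H|) <= #|T| ->
  embeds (copies n H) b setT.
Proof.
move=> rsym rirr bsym total G1 h0 noG arrR Tn; set k := maxn _ _; set h := #|H| => Tk.
have k1 : 1 < k by apply: leq_trans G1 (leq_maxl _ _).
have Gk : #|G| <= k := leq_maxl _ _.
have hk : h <= k := leq_maxr _ _.
have noK Y : ~ kclique r k Y.
  case=> cY Yk; apply: noG; apply: (embedsS (subsetT Y)).
  by apply: clique_embeds; rewrite ?Yk.
(* Enough vertices to force a blue clique of any size up to 2k, as there is no red k-clique; size 2h
   is needed for tiling A. *)
set M := 2 ^ (3 * k).
have ram t (X : {set T}) : t <= k.*2 -> M <= #|X| ->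
    exists2 Z : {set T}, Z \subset X & kclique b t Z.
  move=> tk MX; case: (@ramsey_clique _ _ _ rsym bsym total k t X) => //.
    by apply: leq_trans MX; rewrite leq_pexp2l //; lia.
  by case=> Y _ /noK.
have big_k : 28 * (k * M) + k <= 2 ^ (7 * k).
  have kk : k < 2 ^ k := ltn_expl k (ltnSn 1).
  have M64 : 2 ^ 6 <= M by rewrite leq_pexp2l //; lia.
  have -> : 2 ^ (7 * k) = 2 ^ k * M * M.
    by rewrite /M -!expnD; congr (_ ^ _); lia.
  have : k * M * 64 <= 2 ^ k * M * M by rewrite leq_mul // leq_mul2r ltnW // orbT.
  have : k <= k * M by rewrite leq_pmulr // expn_gt0.
  by clear; lia.
(* Passing to red neighbourhoods costs at most a factor 16^k = 2^(4k), which leaves 2^(7k) of the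
   2^(11k) vertices. *)
have [|||S _ [Sbig Sdeg]] := @sparse_subset _ r rsym rirr 16 (2 ^ (7 * k)) k setT.
- by [].
- by move=> Y _; apply: noK.
- rewrite cardsT (_ : 16 = 2 ^ 4) // -expnM -expnD; apply: leq_trans Tk.
  by rewrite leq_pexp2l //; lia.
(* Arbitrary blue copies of H are packed here, not only cliques, so that the uncovered part U
   contains no blue H at all. *)
pose P1 (X : {set T}) := X \subset ~: S /\ tile H b X.
have [X [_ [_ Xh]]|F1 [t1 FP1 max1]] := @maximal_packing _ P1.
  by rewrite -card_gt0 Xh.
set U := ~: S :\: cover F1.
have noH (Y : {set T}) : Y \subset U -> ~ embeds H b Y.
  move=> YU /embeds_tile[X XY tX]; have /subsetDP[XS XF] := subset_trans XY YU.
  by move: (max1 X); rewrite XF => /(_ (conj XS tX)).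
have UM : #|U| < M.
  rewrite ltnNge; apply/negP=> /(ram h)[|Z ZU [cZ Zh]]; first by lia.
  by apply: (noH Z) => //; apply: clique_embeds; rewrite ?Zh.
pose P2 (X : {set T}) := kclique b h X /\ exists2 u, u \in U & u \in X /\ X :\ u \subset S.
have [X [[_ Xh] _]|F2 [t2 FP2 max2]] := @maximal_packing _ P2.
  by rewrite -card_gt0 Xh.
set U2 := U :\: cover F2; set A := S :\: cover F2.
have UnS u : u \in U -> u \notin S by rewrite !inE => /andP[].
(* Every tile of [F2] uses up a vertex of U, so there are at most M tiles and S loses at most hM
   vertices to them. *)
have cF2 : #|cover F2| <= h * M.
  rewrite (@card_tiled _ h F2) //; last by move=> X /FP2[[]].
  rewrite mulnC leq_mul2l; apply/orP; right; apply: leq_trans (ltnW UM).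
  have := @count_blocks _ 1 F2 U t2; rewrite muln1; move/(_ _)/leq_trans; apply.
    by move=> X /FP2[_ [u uU [uX _]]]; rewrite card_gt0; apply/set0Pn; exists u; rewrite inE uX.
  by rewrite subset_leq_card // subsetIr.
have Acard : #|S| <= #|A| + h * M.
  have := cardsD S (cover F2); have := subset_leq_card (subsetIr S (cover F2)).
  by rewrite -/A; lia.
have U2A : [disjoint U2 & A].
  rewrite disjoints_subset; apply/subsetP=> x; rewrite !inE.
  by case/and3P=> _ _ /negbTE->; rewrite andbF.
(* Otherwise the blue neighbours of u in A contain a blue h-clique; h - 1 of its vertices together
   with u could be added to [F2]. *)
have U2deg u : u \in U2 -> #|A :\: nbr r u| <= M.
  move=> uU2; have uA : u \notin A by rewrite (disjointFr U2A).
  apply: leq_trans (_ : #|A :&: nbr b u| <= _).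
    apply/subset_leq_card/subsetP=> x /setDP[xA]; rewrite !inE in xA *.
    move=> nr; rewrite xA /=; have := total u x; rewrite (negbTE nr); apply.
    by apply: contraNneq uA => ->; rewrite !inE.
  rewrite leqNgt; apply/negP=> /ltnW/(ram h)[|Z ZA [cZ Zh]]; first by lia.
  have [Y YZ Yh] := @exists_subset_card _ Z h.-1 ltac:(lia).
  have /subsetIP[YA Yu] := subset_trans YZ ZA.
  have /setDP[uU uF2] := uU2.
  have uY : u \notin Y by apply: contra uA; apply/subsetP.
  have /subsetDP[YS YF2] := YA.
  move: (max2 (u |: Y)); rewrite disjointsU1 uF2 YF2 => /(_ _)/negP; apply => //.
  split; last first.
    by exists u => //; rewrite setU11 setU1K.
  by split; [apply: cliqueU1 => //; apply: cliqueS cZ | rewrite cardsU1 uY Yh add1n prednK].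
(* R vertices of [U2] would contain a blue H, excluded by the choice of [F1], or a red member of
   D(G), which extends into A to a red G. *)
have U2R : #|U2| < R.
  rewrite ltnNge; apply/negP=> /(arrows_embeds rsym total arrR)[] [K KF emb].
    case: KF emb => I mI -> emb; apply: noG.
    have /card_gt0P[x0 _] : 0 < #|T| by apply: leq_trans Tk; rewrite expn_gt0.
    apply: (@embeds_delete _ x0 r G I U2 A M) => //; first exact: maxsetp mI.
    have : #|G| * M <= k * M by rewrite leq_mul2r Gk orbT.
    have : h * M <= k * M by rewrite leq_mul2r hk orbT.
    by lia.
  by apply: (noH U2); rewrite ?subsetDl //; rewrite -KF.
have [|||U3 U3A [U3h [F3 [t3 c3 FP3]]]] :=
    @dense_tiling _ _ _ rsym bsym total h M (#|S| %/ 16) A h0.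
- by move=> X; apply: ram; lia.
- move=> x xA; rewrite leq_divRL // mulnC; apply: leq_trans (Sdeg x _).
    by rewrite leq_mul2l /= subset_leq_card // setSI // subsetDl.
  by case/setDP: xA.
- have : h * M <= k * M by rewrite leq_mul2r hk orbT.
  by have := leq_divM #|S| 16; lia.
pose F := F1 :|: F2 :|: F3.
have sub1 : cover F1 \subset ~: S by apply/bigcupsP=> X /FP1[].
have dU1 : [disjoint cover F1 & U].
  by rewrite disjoint_sym disjoints_subset subsetDr.
have d12 : [disjoint cover F1 & cover F2].
  rewrite disjoint_sym disjoints_subset; apply/subsetP=> x.
  case/bigcupP=> X /FP2[_ [u uU [uX XS]]] xX; rewrite inE.
  have [->|xu] := eqVneq x u; first by rewrite (disjointFl dU1 uU).
  have xS : x \in S by apply: (subsetP XS); rewrite !inE xu.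
  by apply/negP=> /(subsetP sub1); rewrite inE xS.
have dA : [disjoint cover F1 :|: cover F2 & cover F3].
  rewrite c3 disjoint_sym disjoints_subset; apply/subsetP=> x.
  case/setDP=> /setDP[xS xF2] _; rewrite inE; apply/negP=> xF.
  by case/setUP: xF => [/(subsetP sub1)|]; [rewrite inE xS | rewrite (negbTE xF2)].
have tF : trivIset F.
  apply: trivIsetU => //; last by rewrite coverU.
  exact: trivIsetU.
have Ftile X : X \in F -> tile H b X.
  case/setUP=> [/setUP[/FP1[] | /FP2[kX _]] | /FP3 kX] //; exact: clique_tile.
apply: (tiles_copies tF Ftile).
have Fcard : #|cover F| = #|F| * h by apply: card_tiled => // X /Ftile[].
have : #|~: cover F| <= #|U2| + #|U3|.
  apply: leq_trans (leq_card_setU _ _).1; apply/subset_leq_card/subsetP=> x.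
  rewrite /F !coverU c3 !inE; case: (x \in U3); rewrite ?orbT //=.
  by case: (x \in S); case: (x \in cover F1); case: (x \in cover F2).
have := cardsC (cover F); rewrite Fcard => cC le.
(* At most (R - 1) + (h - 1) vertices are uncovered, so nh + R - 1 <= |F|h + R + h - 2. *)
have : n * h < #|F|.+1 * h by rewrite mulSn; move: Tn cC le U2R U3h; clear; lia.
by rewrite ltn_pmul2r.
Qed.

(** * The lower bound *)

Lemma not_arrows_copies (G H : sgraph) (n p N : nat) :
  connected_graph H -> 0 < n -> ~ arrows (delete_family G) (single H) p ->
  N <= n * #|H| - 1 + p -> ~ arrows (single G) (single (copies n H)) N.
Proof.
case=> h0 Hconn n0 /asboolPn/existsp_asboolPn[c0 c0P] Np.
set a := n * #|H| - 1 in Np.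
pose upper (x : 'I_N) := a <= x.
pose shift (x y : 'I_N) := [set i : 'I_p | (i + a == x) || (i + a == y)].
(* The first a vertices span a blue clique, the upper ones carry [c0] translated by a, and all pairs
   between the two parts are red. *)
pose col x y := if upper x && upper y then c0 (shift x y) else upper x != upper y.
have [|c cE] := @pair_colouring _ col.
  move=> x y; rewrite /col andbC eq_sym; congr (if _ then c0 _ else _).
  by apply/setP=> i; rewrite !inE orbC.
have low (x : 'I_N) : upper x -> x - a < p.
  by move=> ux; have := ltn_ord x; rewrite /upper in ux; lia.
have restrict (K : sgraph) v (f : K -> 'I_N) : injective f -> (forall x, upper (f x)) ->
    (forall x y, adj x y -> colour_adj c v (f x) (f y)) -> subgraph K (colour_graph c0 v).
  move=> finj fu fc; pose g x := Ordinal (low _ (fu x)).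
  have ginj : injective g.
    move=> x y [gxy]; apply/finj/val_inj => /=; have := fu x; have := fu y.
    by rewrite /upper; lia.
  exists g => // x y xy; have /andP[fxy] := fc x y xy; rewrite cE // /col !fu /= => /eqP <-.
  rewrite /= /colour_adj (inj_eq ginj) -(inj_eq finj) fxy /=; apply/eqP; congr c0.
  apply/setP=> i; rewrite !inE -!val_eqE /=; have := fu x; have := fu y; rewrite /upper.
  lia.
case/(_ c) => -[K -> [f finj fadj]]; apply: c0P.
  (* A red G has no edge in the lower part, so its vertices there lie in a maximal independent set
     I; what remains after deleting I is a red member of D(G) in the upper part. *)
  left; pose I0 := [set x | ~~ upper (f x)].
  have /maxset_exists[I mI I0I] : independent I0.
    apply/forall_inP=> x; rewrite inE => xI; apply/forall_inP=> y; rewrite inE => yI.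
    apply/negP=> /fadj /andP[fxy]; rewrite cE // /col.
    by rewrite (negbTE xI) (negbTE yI).
  exists (delete I); first by exists I.
  apply: (restrict (delete I) true (fun x => f (val x))).
  - by move=> x y /finj/val_inj.
  - by case=> x xI /=; apply: contraNT xI => fx; apply: (subsetP I0I); rewrite inE.
  - by move=> x y; apply: fadj.
(* The lower part is one vertex short of n|H|, so some copy of H meets the upper part. *)
right; have [/existsP[[i x] ux]|/existsPn down] := boolP [exists u, upper (f u)]; last first.
  have : #|[set: 'I_n * H]| <= #|[set: 'I_a]|.
    pose g (u : 'I_n * H) : nat := f u.
    have ga u : g u < a by rewrite ltnNge down.
    have ginj : injective (fun u => Ordinal (ga u)).
      by move=> u v [/val_inj/finj].
    by rewrite !cardsT; apply: leq_card ginj.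
  rewrite !cardsT card_prod !card_ord /a; have : 0 < n * #|H| by rewrite muln_gt0 n0.
  by lia.
exists H => //; apply: (restrict H false (fun y => f (i, y))).
- by move=> y z /finj[].
(* No blue edge joins the two parts, so by connectedness this copy of H lies entirely in the upper
   part. *)
- move=> y; pose B := [pred y | upper (f (i, y))].
  suff : (x \in B) = (y \in B) by rewrite !inE ux.
  apply: (@closed_connect _ (@adj H)) (Hconn x y) => u v uv; rewrite !inE.
  have /andP[fuv] : colour_adj c false (f (i, u)) (f (i, v)).
    by apply: fadj; rewrite /= /copies_adj eqxx.
  by rewrite cE // /col; case: (upper _); case: (upper _).
- by move=> y z yz; apply: fadj; rewrite /= /copies_adj eqxx.
Qed.

(** * Ramsey numbers as minima, and the equality *)

Lemma ramsey_least (A B : Defs.family) N :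
  arrows A B N ->
  arrows A B (ramsey A B) /\ forall M, arrows A B M -> ramsey A B <= M.
Proof.
move=> AN; have ex : exists N, `[< arrows A B N >] by exists N; apply/asboolP.
have ex_least : exists N, arrows A B N /\ forall M, arrows A B M -> N <= M.
  case: (ex_minnP ex) => m /asboolP Am mP.
  by exists m; split=> // k /asboolP/mP.
exact: (xgetPex 0 ex_least).
Qed.

Lemma ramsey_eq (A B : Defs.family) N :
  arrows A B N -> (forall M, M < N -> ~ arrows A B M) -> ramsey A B = N.
Proof.
move=> AN least; have [Ar rmin] := ramsey_least AN.
apply/eqP; rewrite eqn_leq rmin //= leqNgt; apply/negP=> /least; exact.
Qed.

Lemma exists_delete_family (G : sgraph) : exists K, delete_family G K.
Proof.
have /maxset_exists[I mI _] : @independent G set0.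
  by apply/forall_inP=> x; rewrite inE.
by exists (delete I); exists I.
Qed.

(** An independent set misses an end of any edge, so every member of D(G) has a vertex, as has H.
    Positivity makes the truncated subtraction of 1 in the formula harmless. *)
Lemma ramsey_delete_gt0 (G H : sgraph) N :
  has_edge G -> 0 < #|H| -> arrows (delete_family G) (single H) N -> 0 < N.
Proof.
move=> [x [y xy]] /card_gt0P[z _] arr; case: N arr => // /(_ xpredT).
case=> -[K]; last by move=> -> [f _ _]; case: (f z).
case=> I /maxsetp /forall_inP indI -> [f _ _].
have [xI|xI] := boolP (x \in I); last by case: (f (exist _ x xI)).
have yI : y \notin I.
  by apply: contraTN xy => yI; move/forall_inP: (indI x xI) => /(_ y yI).
by case: (f (exist _ y yI)).
Qed.

Theorem theorem4 (R : realType) :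
  exists2 C : R, (0 < C)%R &
    forall G H : sgraph, has_edge G -> connected_graph H ->
    forall n : nat, (2 `^ (C * (maxn #|G| #|H|)%:R) <= n%:R :> R)%R ->
      ramsey (single G) (single (copies n H)) =
        n * #|H| + ramsey (delete_family G) (single H) - 1.
Proof.
exists 11%:R%R; first by rewrite Num.Theory.ltr0n.
move=> G H edgeG connH n.
rewrite -GRing.natrM powR_mulrn ?Num.Theory.ler0n // -GRing.natrX Num.Theory.ler_nat => big.
have [h0 _] := connH.
have [K DK] := exists_delete_family G.
have [arrR Rmin] := ramsey_least (arrows_ramsey DK (erefl H : single H H)).
have R0 := ramsey_delete_gt0 edgeG h0 arrR.
set r := ramsey (delete_family G) (single H) in arrR Rmin R0 *.
have n0 : 0 < n by apply: leq_trans big; rewrite expn_gt0.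
have nh0 : n <= n * #|H| by rewrite leq_pmulr.
have G1 : 1 < #|G|.
  have [x [y xy]] := edgeG; apply: leq_trans (max_card (mem [set x; y])).
  by rewrite cards2; case: eqVneq xy => // ->; rewrite adj_irr.
(* Below n|H| + r - 1 there are at most (n|H| - 1) + (r - 1) vertices, and r - 1 does not arrow by
   minimality of r. *)
apply: ramsey_eq => [c|N Nlt]; last first.
  apply: (not_arrows_copies (p := r.-1)) => //; last by lia.
  by move/Rmin; lia.
have [redG|noG] := pselect (subgraph G (colour_graph c true)); first by left; exists G.
right; exists (copies n H) => //; apply: embeds_colour.
apply: (exists_copies (colour_adj_sym c true) (colour_adj_irr c true)
  (colour_adj_sym c false) (@colour_total _ c) G1 h0 _ arrR).
- by move/embeds_colour.
- by rewrite card_ord.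
(* Since r > 0, n is at most n|H| + r - 1, so the lower bound 2^(11k) on n passes to the number of
   vertices. *)
- rewrite card_ord; apply: leq_trans big _; lia.
Qed.
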